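(* Let $\beta\geq 2$ be an integer. For fixed $k\in\mathbb{N}$, the sequence $(F_n)$, where $n\in\mathbb{Z}$, defined by \[ F_n=\begin{cases}0 & \text{if } n<1,\\ 1 & \text{if } n=1,\\ (\beta-1)(F_{n-1}+F_{n-2}+\dots+F_{n-k}) & \text{if } n\geq 2,\end{cases} \] is given by the following Binet formula: \[ F_n=\sum_{j=1}^k\frac{r_{k,j}-1}{\beta+(k+1)(r_{k,j}-\beta)}\,r_{k,j}^{\,n-1}, \] where $r_{k,1},\dots,r_{k,k}$ are the roots of the polynomial \[ p_k(x)=x^k-(\beta-1)\sum_{i=0}^{k-1}x^i. \]
   Context: The polynomial $p_k$ is the characteristic polynomial corresponding to the recursion relation that defines $(F_n)$.
   Formalization: The formula is stated for n ≥ 2−k rather than all integers n, since it fails at n = 1−k (it gives 1/(β−1), not 0), and the case β = 2, k = 1 is excluded because the coefficient there is 0/0. *)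

(* Defs.v *)
From HB Require Import structures.
From mathcomp Require Import all_boot all_order all_algebra.
From mathcomp Require Import zify.

Set Implicit Arguments.
Unset Strict Implicit.
Unset Printing Implicit Defensive.

Import Order.TTheory GRing.Theory Num.Theory.
Local Open Scope ring_scope.

Definition is_gen_fibonacci (beta : int) (k : nat) (F : int -> int) : Prop :=
  [/\ forall n : int, n < 1 -> F n = 0,
      F 1 = 1
    & forall n : int, 2 <= n ->
        F n = (beta - 1) * \sum_(1 <= i < k.+1) F (n - i%:Z)].

Definition fib_charpoly (R : nzRingType) (beta : int) (k : nat) : {poly R} :=
  'X^k - (beta - 1)%:~R *: \sum_(0 <= i < k) 'X^i.

(* The recursion has exactly one solution. *)
Fixpoint gen_fibonacci_history (beta : int) (k n : nat) : seq int :=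
  (* [:: F_n; F_(n-1); ...; F_1] *)
  match n with
  | 0 => [::]
  | 1 => [:: 1]
  | m.+1 => let s := gen_fibonacci_history beta k m in
            (beta - 1) * (\sum_(0 <= i < k) s`_i) :: s
  end.

Lemma size_gen_fibonacci_history beta k n :
  size (gen_fibonacci_history beta k n) = n.
Proof. by elim: n => [|[|n] IHn] //=; rewrite -[in RHS]IHn. Qed.

Lemma nth_gen_fibonacci_history beta k n i : (i <= n)%N ->
  (gen_fibonacci_history beta k n)`_i =
  (gen_fibonacci_history beta k (n - i))`_0.
Proof.
elim: n i => [|n IHn] [|i] //= lein.
by rewrite subSS -IHn //; case: n {IHn lein} => [|n] //; case: i.
Qed.

Lemma is_gen_fibonacci_exists beta k : exists F, is_gen_fibonacci beta k F.
Proof.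
pose h n := (gen_fibonacci_history beta k n)`_0.
exists (fun n : int => if n < 1 then 0 else h `|n|%N); split => //.
  by move=> n ->.
move=> n le2n; have -> : n < 1 = false by lia.
have [m ->] : exists m : nat, n = m.+2%:Z by exists (`|n| - 2)%N; lia.
rewrite /h absz_nat /=; congr (_ * _).
rewrite big_add1 /=; apply: eq_bigr => i _.
have [lti|lei] := leqP i.+1 m.+1; last first.
  have -> : m.+2%:Z - i.+1%:Z < 1 by lia.
  by rewrite nth_default // (size_gen_fibonacci_history beta k m.+1).
have -> : m.+2%:Z - i.+1%:Z < 1 = false by lia.
rewrite (@nth_gen_fibonacci_history beta k m.+1 i) 1?ltnW //.
by congr (gen_fibonacci_history _ _ _)`_0; lia.
Qed.

Lemma is_gen_fibonacci_unique beta k F G :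
  is_gen_fibonacci beta k F -> is_gen_fibonacci beta k G -> F =1 G.
Proof.
move=> [F0 F1 Frec] [G0 G1 Grec].
suff FG (m : nat) (n : int) : n <= m%:Z -> F n = G n.
  by move=> n; apply: (FG `|n|%N); lia.
elim: m n => [|m IHm] n len; first by rewrite F0 ?G0 //; lia.
have [lt1|] := ltP n 1; first by rewrite F0 ?G0.
rewrite le_eqVlt => /orP[/eqP<-|lt1]; first by rewrite F1 G1.
rewrite Frec ?Grec; [|lia|lia]; congr (_ * _).
by apply: eq_big_nat => i /andP[lt0i _]; apply: IHm; lia.
Qed.

(* Main.v *)
Require Import Defs.
From HB Require Import structures.
From mathcomp Require Import all_boot all_order all_algebra.
From mathcomp Require Import zify ring.

Set Implicit Arguments.
Unset Strict Implicit.
Unset Printing Implicit Defensive.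

Import Order.TTheory GRing.Theory Num.Theory.
Local Open Scope ring_scope.

(** Write p for the characteristic polynomial and b for beta.  Summing the
    geometric progression gives (x - 1) p(x) = x^(k+1) - b x^k + (b - 1).
    Differentiating this identity at a root r of p yields
      r^(k-1) ((k+1) r - k b) = (r - 1) p'(r),
    and (k+1) r - k b is precisely the denominator b + (k+1)(r - b) of the
    Binet formula ([fib_denominatorE]).

    The denominator never vanishes: otherwise r = k b / (k+1), and substituting
    this rational number in the trinomial leaves the integer equation
    k^k b^(k+1) = (b-1) (k+1)^(k+1), whose only positive solution is the excluded
    k = 1, b = 2 by coprimality of consecutive integers
    ([consecutive_expn_eq]).  Consequently p'(r) <> 0 at every root, so the
    roots are distinct and the j-th Binet coefficient is r_j^(k-1) / p'(r_j).

    The formula now reads F_n = \sum_j r_j^(n+k-2) / p'(r_j).  Both sides obey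
    the same recursion of order k, so it suffices to compare them on the k
    consecutive indices 2 - k <= n <= 1, where the exponent runs over
    0, ..., k - 1.  There, Lagrange interpolation of 'X^m at the roots, read off
    in degree k - 1, evaluates the sum to 1 if m = k - 1 and to 0 otherwise
    ([sum_horner_div_deriv]), which is F_n. *)

(** * Lagrange interpolation *)

Section Lagrange.
Variables (R : fieldType) (k : nat) (r : 'I_k -> R).

Let p : {poly R} := \prod_(j < k) ('X - (r j)%:P).
Let cofactor_poly j : {poly R} := \prod_(i < k | i != j) ('X - (r i)%:P).

Lemma horner_deriv_prod_XsubC j : p^`().[r j] = (cofactor_poly j).[r j].
Proof.
have -> : p = ('X - (r j)%:P) * cofactor_poly j.
  by rewrite /p (bigD1 j).
by rewrite derivM derivXsubC mul1r !hornerE subrr mul0r addr0.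
Qed.

Lemma horner_cofactor_poly i j : i != j -> (cofactor_poly j).[r i] = 0.
Proof.
move=> ij; rewrite /cofactor_poly (bigD1 i) //=.
by rewrite hornerM hornerXsubC subrr mul0r.
Qed.

(** If r_i = r_j with i <> j, then 'X - r_j still divides p / ('X - r_j), whose
    value at r_j is p'(r_j). *)
Lemma simple_roots_inj : (forall j, p^`().[r j] != 0) -> injective r.
Proof.
move=> p'n0 i j rij; apply/eqP; apply: contraT => ij.
by move: (p'n0 j); rewrite horner_deriv_prod_XsubC -rij horner_cofactor_poly ?eqxx.
Qed.

Lemma size_cofactor_poly j : size (cofactor_poly j) = k.
Proof.
have := size_prod_XsubC (index_enum 'I_k) r.
have -> : size (index_enum 'I_k) = k.
  by rewrite -[RHS]card_ord cardE enumT.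
rewrite (bigD1 j) //= size_Mmonic ?monic_prod_XsubC ?polyXsubC_eq0 //.
by rewrite size_XsubC => -[].
Qed.

(** Interpolating q at the roots of p and comparing the coefficients of degree
    k - 1: the Lagrange basis polynomial at r_j is a monic polynomial of degree
    k - 1 divided by p'(r_j). *)
Lemma sum_horner_div_deriv (q : {poly R}) :
    (forall j, p^`().[r j] != 0) -> (size q <= k)%N ->
  \sum_(j < k) q.[r j] / p^`().[r j] = q`_k.-1.
Proof.
move=> p'n0 szq.
(* s is the Lagrange interpolant of q; q - s has size at most k and k roots *)
pose s := \sum_(j < k) (q.[r j] / p^`().[r j]) *: cofactor_poly j.
have qs : q = s.
  apply/eqP; rewrite -subr_eq0; apply/eqP.
  apply: (@roots_geq_poly_eq0 _ _ (codom r)).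
  - apply/allP=> _ /codomP[i ->]; rewrite rootE hornerD hornerN horner_sum.
    rewrite (bigD1 i) //= big1 ?addr0 => [|j ji]; last first.
      by rewrite hornerZ horner_cofactor_poly 1?eq_sym // mulr0.
    by rewrite hornerZ -horner_deriv_prod_XsubC divfK // subrr.
  - by rewrite map_inj_uniq ?enum_uniq //; apply: simple_roots_inj.
  rewrite size_codom card_ord; apply: leq_trans (size_polyD _ _) _.
  rewrite geq_max szq size_polyN; apply: leq_trans (size_sum _ _ _) _.
  apply/bigmax_leqP=> j _.
  by rewrite (leq_trans (size_scale_leq _ _)) ?size_cofactor_poly.
rewrite [in RHS]qs coef_sum; apply: eq_bigr => j _; rewrite coefZ.
have /monicP := monic_prod_XsubC (index_enum 'I_k) (fun i => i != j) r.
by rewrite /lead_coef size_cofactor_poly => ->; rewrite mulr1.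
Qed.

End Lagrange.

(** * The denominators *)

(** The integer equation behind a vanishing denominator.  Since n and n + 1 are
    coprime, and so are b and b + 1, the powers of b + 1 and of n + 1 divide each
    other, whence b = n and n^n = n. *)
Lemma consecutive_expn_eq (b n : nat) :
    (0 < b)%N -> (0 < n)%N ->
  (n ^ n * b.+1 ^ n.+1 = b * n.+1 ^ n.+1)%N -> b = 1%N /\ n = 1%N.
Proof.
move=> b_gt0 n_gt0 e.
have dvd1 : (n.+1 ^ n.+1 %| b.+1 ^ n.+1)%N.
  rewrite -(@Gauss_dvdr _ (n ^ n)%N) ?e ?dvdn_mull //.
  by rewrite coprimeXl ?coprimeXr ?coprimeSn.
have dvd2 : (b.+1 ^ n.+1 %| n.+1 ^ n.+1)%N.
  rewrite -(@Gauss_dvdr _ b) -?e ?dvdn_mull //.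
  by rewrite coprimeXl ?coprimeSn.
have /eqP : (b.+1 ^ n.+1 = n.+1 ^ n.+1)%N by apply/eqP; rewrite eqn_dvd dvd2.
rewrite eqn_exp2r // eqSS => /eqP bn; move: e; rewrite bn => e.
have /eqP : (n ^ n = n ^ 1)%N.
  by apply/eqP; rewrite -(@eqn_pmul2r (n.+1 ^ n.+1)) ?expn_gt0 // expn1 e.
have [n_gt1|] := ltnP 1 n; last by lia.
by rewrite eqn_exp2l // => /eqP n1; rewrite n1.
Qed.

Section CharPoly.
Variables (R : idomainType) (beta : int) (k : nat).
Local Notation p := (fib_charpoly R beta k).

(** Multiplying by 'X - 1 telescopes the geometric sum, leaving a trinomial whose
    derivative is easy to evaluate. *)
Lemma XsubC1_mul_fib_charpoly :
  ('X - 1) * p = 'X^(k.+1) - beta%:~R *: 'X^k + ((beta - 1)%:~R)%:P :> {poly R}.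
Proof.
rewrite /fib_charpoly mulrBr -scalerAr big_mkord -subrX1 exprS.
rewrite -!mul_polyC rmorphB rmorph1 polyCB; ring.
Qed.

Lemma root_fib_charpoly x : root p x ->
  x ^+ k * (beta%:~R - x) = (beta - 1)%:~R.
Proof.
move=> /rootP px; have := congr1 (horner^~ x) XsubC1_mul_fib_charpoly.
rewrite hornerM px mulr0 !hornerE exprS => e.
apply/eqP; rewrite -subr_eq0 -oppr_eq0; apply/eqP; rewrite [RHS]e; ring.
Qed.

Lemma root_fib_charpoly_recursion x : root p x ->
  x ^+ k = (beta - 1)%:~R * \sum_(i < k) x ^+ i.
Proof.
move=> /rootP; rewrite /fib_charpoly !hornerE horner_sum big_mkord => /eqP.
rewrite subr_eq0 => /eqP ->; congr (_ * _).
by apply: eq_bigr => i _; rewrite hornerXn.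
Qed.

(** Where the denominators of the Binet formula come from: both sides are the
    derivative of ('X - 1) p at x, the left one computed from the trinomial and
    the right one by Leibniz' rule. *)
Lemma fib_denominatorE x : (0 < k)%N -> root p x ->
  x ^+ k.-1 * (beta%:~R + k.+1%:R * (x - beta%:~R)) = (x - 1) * p^`().[x].
Proof.
move=> k_gt0 /rootP px.
have := congr1 (fun q => q^`().[x]) XsubC1_mul_fib_charpoly.
rewrite derivM -polyC1 derivXsubC mul1r hornerD px add0r hornerM hornerXsubC.
move=> ->; rewrite !derivE !hornerE /=.
case: k k_gt0 => // n _; rewrite !hornerMn !hornerXn /= exprS; ring.
Qed.

End CharPoly.

(** A vanishing denominator forces x = k beta / (k+1), and then the trinomial
    becomes an equation between integers. *)
Lemma fib_denominator_neq0 (R : numFieldType) (beta : int) (k : nat) (x : R) :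
    2 <= beta -> (0 < k)%N -> ~ (beta = 2 /\ k = 1%N) ->
    root (fib_charpoly R beta k) x ->
  beta%:~R + k.+1%:R * (x - beta%:~R) != 0.
Proof.
case: beta => // -[|b] // b_gt0 k_gt0 ndeg /root_fib_charpoly xE.
apply/eqP => D0; apply: ndeg.
have kx : k.+1%:R * x = k%:R * b.+1%:R :> R.
  apply/eqP; rewrite -subr_eq0 -D0; apply/eqP; ring.
have [b1 k1] : b = 1%N /\ k = 1%N; last by rewrite b1 k1.
apply: consecutive_expn_eq => //.
apply: (@mulrIn R 1); first exact: oner_neq0.
rewrite !natrM !natrX.
(* the trinomial equation at x, multiplied by (k+1)^(k+1) *)
have -> : b%:R = x ^+ k * (b.+1%:R - x).
  by rewrite xE intrB /= -[b.+1%:~R]/(b.+1%:R) -addn1 natrD addrK.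
have -> : x ^+ k * (b.+1%:R - x) * k.+1%:R ^+ k.+1 =
   (k.+1%:R * x) ^+ k * (k.+1%:R * b.+1%:R - k.+1%:R * x).
  by rewrite exprMn [k.+1%:R ^+ k.+1]exprS; ring.
rewrite kx exprMn [b.+1%:R ^+ k.+1]exprS; ring.
Qed.

(** * The recursion *)

Lemma eq_linear_recursion (R : pzRingType) (k : nat) (a : nat -> R) (N : int)
    (u v : int -> R) :
    (forall n, N <= n -> u n = \sum_(1 <= i < k.+1) a i * u (n - i%:Z)) ->
    (forall n, N <= n -> v n = \sum_(1 <= i < k.+1) a i * v (n - i%:Z)) ->
    (forall n, N - k%:Z <= n -> n < N -> u n = v n) ->
  forall n, N - k%:Z <= n -> u n = v n.
Proof.
move=> urec vrec init n le_n.
suff uv (m : nat) : forall n : int, N - k%:Z <= n -> n < N + m%:Z -> u n = v n.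
  by apply: (uv `|n - N|.+1%N) => //; lia.
elim: m => [|m IHm] l le_l lt_l; first by apply: init => //; lia.
have [lN|Nl] := ltP l N; first exact: init.
rewrite urec // vrec //; apply: eq_big_nat => i /andP[i_gt0 i_le].
by rewrite IHm //; lia.
Qed.

(** As x is invertible, its powers obey the recursion for all integer exponents.
    Negative ones occur: for n = 2 the recursion reaches back to F_(2-k), whose
    Binet formula involves x^(1-k). *)
Lemma root_fib_charpoly_exprz (R : fieldType) (beta : int) (k : nat) (x : R) :
    x != 0 -> root (fib_charpoly R beta k) x ->
  forall n : int,
    x ^ n = \sum_(1 <= i < k.+1) (beta - 1)%:~R * x ^ (n - i%:Z).
Proof.
move=> x_neq0 px n.
have -> : x ^ n = x ^ (n - k%:Z) * x ^+ k.
  by rewrite -[x ^+ k]/(x ^ k%:Z) -expfzDr // subrK.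
rewrite (root_fib_charpoly_recursion px) mulrCA -mulr_sumr; congr (_ * _).
rewrite mulr_sumr big_add1 /= big_mkord (reindex_inj rev_ord_inj) /=.
apply: eq_bigr => i _.
rewrite -[x ^+ _]/(x ^ (k - i.+1)%N%:Z) -expfzDr //; congr (x ^ _).
by have := ltn_ord i; lia.
Qed.

Theorem lemma3p2 (C : numClosedFieldType) (beta : int) (k : nat)
    (F : int -> int) (r : 'I_k -> C)
    (hbeta : 2 <= beta) (hk : (1 <= k)%N)
    (hdegenerate : ~ (beta = 2 /\ k = 1%N))
    (hF : is_gen_fibonacci beta k F)
    (hr : fib_charpoly C beta k = \prod_(j < k) ('X - (r j)%:P)) :
  (forall j : 'I_k, beta%:~R + k.+1%:R * (r j - beta%:~R) != 0) /\
  (forall n : int, 2 - k%:Z <= n ->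
     (F n)%:~R =
       \sum_(j < k)
         (r j - 1) / (beta%:~R + k.+1%:R * (r j - beta%:~R)) * r j ^ (n - 1)).
Proof.
have proot j : root (fib_charpoly C beta k) (r j).
  by rewrite hr rootE horner_prod (bigD1 j) //= !hornerE subrr mul0r.
have D_neq0 j := fib_denominator_neq0 hbeta hk hdegenerate (proot j).
split=> //.
(* the trinomial takes the value beta - 1 at 0 *)
have r_neq0 j : r j != 0.
  apply/eqP => rj0; have := root_fib_charpoly (proot j).
  rewrite rj0 expr0n gtn_eqF // mul0r => /esym/eqP.
  by rewrite intr_eq0; lia.
have DE j := fib_denominatorE hk (proot j).
have p'_neq0 j : (fib_charpoly C beta k)^`().[r j] != 0.
  apply: contraTneq (D_neq0 j) => p'0.
  move/eqP: (DE j); rewrite p'0 mulr0 mulf_eq0 expf_eq0 (negPf (r_neq0 j)).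
  by rewrite andbF /= => /eqP ->; rewrite eqxx.
have coefE j : (r j - 1) / (beta%:~R + k.+1%:R * (r j - beta%:~R)) =
               r j ^+ k.-1 / (fib_charpoly C beta k)^`().[r j].
  by apply/eqP; rewrite eqr_div // DE.
have [F0 F1 Frec] := hF.
apply: (@eq_linear_recursion _ k (fun=> (beta - 1)%:~R)).
- move=> n n_ge2; rewrite Frec // rmorphM rmorph_sum /= mulr_sumr.
  by apply: eq_bigr.
- move=> n _.
  under [RHS]eq_bigr do rewrite mulr_sumr.
  rewrite exchange_big /=; apply: eq_bigr => j _.
  rewrite (root_fib_charpoly_exprz (r_neq0 j) (proot j)) mulr_sumr.
  by apply: eq_bigr => i _; rewrite mulrCA [n - 1 - _]addrAC.
move=> n n_ge n_lt2.
(* n - 1 = m - (k - 1) with 0 <= m <= k - 1 *)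
have [m mE] : exists m : nat, m%:Z = n + k%:Z - 2.
  by exists `|(n + k%:Z - 2)%R|%N; lia.
have szXm : (size ('X^m : {poly C}) <= k)%N by rewrite size_polyXn; lia.
transitivity (('X^m : {poly C})`_k.-1).
  rewrite coefXn; have [km|km] := eqVneq k.-1 m.
    have -> : n = 1 by lia.
    by rewrite F1.
  by rewrite F0 //; lia.
rewrite hr in p'_neq0 coefE.
rewrite -(sum_horner_div_deriv p'_neq0 szXm).
apply: eq_bigr => j _; rewrite coefE hornerXn mulrAC; congr (_ / _).
rewrite -[_ ^+ m]/(_ ^ m%:Z) -[_ ^+ k.-1]/(_ ^ k.-1%:Z) -expfzDr //.
by congr (_ ^ _); lia.
Qed.
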